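(* Every 2-colouring of $\mathbb{N}$ has infinitely many monochromatic solutions to $x+y=z^2$. Moreover, there exists $N_0$ such that for every integer $N\ge N_0$ and every 2-colouring of the integer interval $[N,10^4N^4]$, there exist $x,y,z\in[N,10^4N^4]$, all of the same colour, with $x+y=z^2$.
   Context: $\mathbb{N}$ denotes the positive integers. An interval $[a,b]$ denotes the set of integers that are at least $a$ and at most $b$. A 2-colouring of a set is a function from the set to a two-element set; a solution $(x,y,z)$ is monochromatic if $x,y,z$ all receive the same colour. The variables $x,y,z$ need not be distinct. *)

(* Defs.v *)
From mathcomp Require Import all_boot.
From mathcomp Require Import classical_sets cardinality.

Set Implicit Arguments.
Unset Strict Implicit.
Unset Printing Implicit Defensive.

Local Open Scope classical_set_scope.

Definition posn : set nat := [set n | 0 < n].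

Definition itvn (a b : nat) : set nat := [set n | a <= n <= b].

(* A 2-colouring of A is a function on the subtype of elements of A; x, y, z
   range over that subtype, and x + y = z ^ 2 is read in nat. *)
Definition mono_solutions (A : set nat) (c : A -> bool) : set (A * A * A) :=
  [set s | let: (x, y, z) := s in
    [/\ val x + val y = val z ^ 2, c x = c y & c y = c z]].

(* Main.v *)
(* Fix a 2-colouring of [N, 10^4 N^4], N large, without monochromatic solutions.
   If z has colour t and z + 1
   does not, then x of colour t forces z^2 - x to have the other colour, hence
   x + (2z + 1) = (z + 1)^2 - (z^2 - x) to have colour t: the colour class of t is
   closed under adding d = 2z + 1. If z' switches the other way, it is also closed
   under subtracting d' = 2z' + 1, so it is preserved by the rotation by d of any
   window of length d + d', and then so is its complement. This is absurd because
   some x near z^2 / 2 and its translate x + d have different colours.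

   Let t be the colour of 14N and let m be the last element of the initial run of
   colour t in [14N, 98N^2]. The run is not the whole interval since
   98N^2 + 98N^2 = (14N)^2. If m <= 16N^2, then m + (2m + 1) has colour t again, so
   there is a second, opposite switch. Otherwise v = m + 6(2m + 1) has colour t and
   v + x = w^2 for some x and w in [14N, m]. *)
Require Import Defs.
From Stdlib Require PeanoNat.
From mathcomp Require Import all_boot.
From mathcomp Require Import classical_sets cardinality.
From mathcomp Require Import boolp zify.

Set Implicit Arguments.
Unset Strict Implicit.
Unset Printing Implicit Defensive.

Local Open Scope classical_set_scope.

Definition mono_free (c : nat -> bool) (N M : nat) : Prop :=
  forall x y z, N <= x <= M -> N <= y <= M -> N <= z <= M ->
  x + y = z ^ 2 -> c x = c z -> c y = ~~ c z.

(** Rotation by [d] modulo [D] has finite order: [D] steps fix [p], so [D - 1] further steps lead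
    from [(p + d) %% D] back to [p]. *)
Lemma rotation_backward (P : pred nat) (D d : nat) :
  (forall p, p < D -> P p -> P ((p + d) %% D)) ->
  forall p, p < D -> P ((p + d) %% D) -> P p.
Proof.
move=> step p pD Pd; have D0 : 0 < D by lia.
have iterP k : P ((p + k.+1 * d) %% D).
  elim: k => [|k IHk]; first by rewrite mul1n.
  have := step _ (ltn_pmod (p + k.+1 * d) D0) IHk.
  by rewrite modnDml -addnA -mulSnr.
have := iterP D.-1.
by rewrite prednK // addnC mulnC modnMDl modn_small.
Qed.

Lemma exists_switch (c : nat -> bool) (t : bool) (a b : nat) :
  a <= b -> c a = t -> c b = ~~ t ->
  exists m, [/\ a <= m < b, c m.+1 = ~~ t & forall i, a <= i <= m -> c i = t].
Proof.
move=> ab ca cb.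
have ex : exists i, (a <= i) && (c i != t).
  by exists b; rewrite ab cb; case: (t).
case: (ex_minnP ex) => u /andP[au cu] umin.
have {}au : a < u by rewrite ltn_neqAle au andbT; apply: contraNneq cu => <-; apply/eqP.
exists u.-1; split.
- by have := umin b; rewrite ab cb; case: (t) => /= /(_ isT); lia.
- by rewrite prednK; [move: cu; case: (c u); case: (t) | lia].
- move=> i /andP[ai iu]; apply/eqP; apply: contraT => ci.
  by have := umin i; rewrite ai ci => /(_ isT); lia.
Qed.

Section MonoFree.
Variables (c : nat -> bool) (N M : nat).
Hypothesis free : mono_free c N M.

Lemma not_mono (x y z : nat) :
  N <= x <= M -> N <= y <= M -> N <= z <= M ->
  c x = c z -> c y = c z -> x + y <> z * z.
Proof. by move=> xr yr zr cx cy /(free xr yr zr) /(_ cx); rewrite cy; case: (c z). Qed.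

Lemma shift_switch (t : bool) (z x : nat) :
  c z = t -> c z.+1 = ~~ t -> N <= z -> z.+1 ^ 2 <= M ->
  N <= x -> x + N <= z ^ 2 -> c x = t -> c (x + (2 * z + 1)) = t.
Proof.
move=> cz cz1 Nz zM Nx xz cx; rewrite -!mulnn in zM xz.
have cy : c (z ^ 2 - x) = ~~ t.
  by rewrite -cz; apply: (free (x := x)); rewrite ?cx ?cz // -?mulnn; nia.
rewrite -[RHS]negbK -cz1; apply: (free (x := z ^ 2 - x)); rewrite ?cy ?cz1 // -?mulnn; nia.
Qed.

Lemma no_opposite_switches (t : bool) (z z' : nat) :
  0 < N -> 5 * N < z -> z <= z' -> 4 * z' + 2 * N + 2 <= z ^ 2 -> z'.+1 ^ 2 <= M ->
  c z = t -> c z.+1 = ~~ t -> c z' = ~~ t -> c z'.+1 = t -> False.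
Proof.
rewrite -!mulnn => N0 Nz zz' z'z z'M cz cz1 cz' cz'1.
pose d := 2 * z + 1; pose d' := 2 * z' + 1.
(* The even one of z^2 and (z+1)^2 has its half coloured by the mere absence of
   solutions with x = y. *)
have [x [xN xz cx cxd]] : exists x, [/\ N <= x, 2 * x <= z * z, c x = ~~ t & c (x + d) = t].
  have [hz|hz] := boolP (odd z).
    have [k zk] : exists k, z = 2 * k + 1 by exists z./2; lia.
    have cxd : c ((2 * k * k + 4 * k + 2)) = t.
      have := free (x := 2 * k * k + 4 * k + 2) (y := 2 * k * k + 4 * k + 2) (z := z.+1).
      rewrite -mulnn cz1 negbK; case: (c (_ + _)); case: (t); intuition nia.
    (* Here [x + d] is half of [z.+1 ^ 2] and [x + (x + d) = z ^ 2]; in the even case [x] is half of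
       [z ^ 2] and [x + (x + d) = z.+1 ^ 2]. *)
    exists (2 * k * k - 1); split; try nia.
      rewrite -cz; apply: (free (x := 2 * k * k - 1 + d)); rewrite -?mulnn /d; try nia.
      by rewrite cz -[RHS]cxd; congr c; nia.
    by rewrite -[RHS]cxd; congr c; rewrite /d; nia.
  have [k zk] : exists k, z = 2 * k by exists z./2; lia.
  have cx : c (2 * k * k) = ~~ t.
    have := free (x := 2 * k * k) (y := 2 * k * k) (z := z).
    rewrite -mulnn cz; case: (c (_ * _)); case: (t); intuition nia.
  exists (2 * k * k); split=> //; try nia.
  rewrite -[RHS]negbK -cz1; apply: (free (x := 2 * k * k)); rewrite -?mulnn /d ?cz1 //; nia.
have zz : z.+1 * z.+1 <= z'.+1 * z'.+1 by apply: leq_mul.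
suff : c (x + 0) == t by rewrite addn0 cx; case: (t).
apply: (@rotation_backward (fun p => c (x + p) == t) (d + d') d); [|lia|]; last first.
  by rewrite add0n modn_small ?cxd //; lia.
move=> p pD /eqP cp; apply/eqP.
have [pd'|pd'] := ltnP p d'.
  rewrite modn_small; last by lia.
  by rewrite addnA /d; apply: shift_switch; rewrite -?mulnn //; lia.
(* Now the rotation subtracts [d']: if [x + (p - d')] had colour [~~ t], the switch at [z'] would
   give that colour to [x + p]. *)
have -> : p + d = (p - d') + (d + d') by lia.
rewrite modnDr modn_small; last by lia.
have [//|cq] := eqVneq (c (x + (p - d'))) t.
have := @shift_switch (~~ t) z' (x + (p - d')) cz'.
rewrite -!mulnn cz'1 negbK.
have -> : x + (p - d') + (2 * z' + 1) = x + p by rewrite -addnA subnK.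
rewrite cp => H; have : t = ~~ t; last by case: (t).
apply: H => //; [lia | lia | rewrite /d /d' in pD pd' *; lia |].
by move: cq; case: (c _); case: (t).
Qed.

Lemma mono_free_short : 100 <= N -> M < (98 * N ^ 2) ^ 2.
Proof.
move=> N0; rewrite ltnNge; apply/negP => NM; rewrite -!mulnn in NM.
pose t := c (14 * N).
have NM' : 98 * (N * N) <= M by apply: leq_trans NM; rewrite leq_pmulr // !muln_gt0; lia.
have [c98|c98] := eqVneq (c (98 * (N * N))) t.
  by apply: (@not_mono (98 * (N * N)) (98 * (N * N)) (14 * N)) => //; nia.
have [||//|m [/andP[am mb] cm1 cm]] := @exists_switch c t (14 * N) (98 * (N * N)).
- nia.
- by [].
- by move: c98; case: (c _); case: (t).
have sqM i : i < 98 * (N * N) -> i.+1 * i.+1 <= M.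
  by move=> iN; apply: leq_trans NM; apply: leq_mul.
clear NM; have mM : m.+1 * m.+1 <= M by apply: sqM.
have cmm : c m = t by apply: cm; lia.
have shift x : N <= x -> x + N <= m * m -> c x = t -> c (x + (2 * m + 1)) = t.
  by move=> Nx xm; apply: shift_switch; rewrite -?mulnn //; lia.
have c3 : c (m + (2 * m + 1)) = t.
  apply: shift => //; [lia | clear -am N0; nia].
have [m16|m16] := leqP m (16 * (N * N)).
  have [||//|z' [/andP[az zb] cz1 cz]] :=
      @exists_switch c (~~ t) m.+1 (m + (2 * m + 1)).
  - lia.
  - by [].
  - by rewrite negbK.
  (* As z' <= 3m <= 48N^2, this yields 4z' + 2N + 2 <= 192N^2 + 2N + 2 <= 196N^2 <= m^2. *)
  have am2 : 14 * N * (14 * N) <= m * m by apply: leq_mul.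
  apply: (@no_opposite_switches t m z'); rewrite -?mulnn ?cz1 ?negbK //; try lia.
  - by apply: sqM; clear -zb m16 N0; nia.
  - by apply: cz; lia.
pose d := 2 * m + 1.
have m1600 : 1600 * N <= m by clear -m16 N0; nia.
have c6 : c (m + 6 * d) = t.
  have m14 : 14 * m <= m * m by rewrite leq_mul2r; lia.
  have H k : k <= 6 -> c (m + k * d) = t.
    elim: k => [|k IHk] k6; first by rewrite addn0.
    have kd : k * d <= 5 * d by rewrite leq_mul2r; lia.
    by rewrite mulSnr addnA; apply: shift; [lia | rewrite /d in kd *; lia | apply: IHk; lia].
  exact: H.
(* Six shifts give m + (m + 6d) = 14m + 6 > 224N^2, enough for w >= 14N; the gap 14m + 6 - w^2 <= 2w
   <= m/50 keeps w^2 - (m + 6d) in [14N, m]. *)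
have [w [w1 w2]] : exists w, w * w <= 14 * m + 6 /\ 14 * m + 6 < w.+1 * w.+1.
  by exists (Nat.sqrt (14 * m + 6)); have := PeanoNat.Nat.sqrt_spec (14 * m + 6); lia.
have wm : 100 * w <= m by clear -w1 m1600 N0; nia.
have wN : 14 * N <= w by clear -w2 m16 N0; nia.
have mM' : m <= M by lia.
clear shift sqM c98 cm1 c3 mb NM'.
have w6 : 14 * N + (m + 6 * d) <= w * w <= m + (m + 6 * d) by rewrite /d; lia.
have cw : c w = t by apply: cm; lia.
have cx : c (w * w - (m + 6 * d)) = t by apply: cm; lia.
have w6M : w * w <= M by apply: leq_trans mM; apply: leq_mul; lia.
by apply: (@not_mono (m + 6 * d) (w * w - (m + 6 * d)) w); rewrite ?cw ?cx ?c6 //; lia.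
Qed.

End MonoFree.

(** A general [A] serves both the interval and [posn]; the bound on [z] lets a solution escape any
    finite list. *)
Lemma exists_mono_solution (A : set nat) (c : A -> bool) (N : nat) :
  100 <= N -> itvn N (10 ^ 4 * N ^ 4) `<=` A ->
  exists x y z : A, mono_solutions c (x, y, z) /\ N <= val z.
Proof.
move=> N100 subA; set M := 10 ^ 4 * N ^ 4 in subA *.
have NM : (98 * N ^ 2) ^ 2 <= M.
  have -> : M = (100 * N ^ 2) ^ 2 by rewrite [RHS]expnMn -expnM /M; congr (_ * _).
  by rewrite leq_sqr leq_mul2r orbT.
(* The default [false] is harmless: [mono_free e N M] only concerns values on [N, M], which lies in
   [A]. *)
pose e n := oapp c false (insub n).
have eE (a : A) : e (val a) = c a by rewrite /e valK.
apply: contrapT => nosol; suff free : mono_free e N M.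
  by have := mono_free_short free N100; rewrite ltnNge NM.
move=> x y z /subA Ax /subA Ay Nz xyz exz; have Az := subA _ Nz.
pose sub n (An : A n) : A := SigSub (mem_set An).
have [eyz|] := eqVneq (e y) (e z); last by case: (e y); case: (e z).
case: nosol; exists (sub x Ax), (sub y Ay), (sub z Az); split; last by case/andP: Nz.
by split; rewrite // -!eE /= ?exz eyz.
Qed.

Theorem theorem1 :
  (forall c : posn -> bool, infinite_set (mono_solutions c)) /\
  (exists N0 : nat, forall N : nat, N0 <= N ->
     forall c : itvn N (10 ^ 4 * N ^ 4) -> bool,
     exists x y z : itvn N (10 ^ 4 * N ^ 4), mono_solutions c (x, y, z)).
Proof.
split=> [c /finite_seqP[s sE]|]; last first.
  exists 100 => N N100 c.
  by have [x [y [z [sol _]]]] := exists_mono_solution c N100 (fun=> id); exists x, y, z.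
pose N := 100 + \max_(p <- s) val p.2.
have subA : itvn N (10 ^ 4 * N ^ 4) `<=` posn by move=> n /andP[+ _]; apply: leq_trans.
have [x [y [z [sol Nz]]]] := exists_mono_solution c (leq_addr _ _) subA.
have sol_s : (x, y, z) \in s by move: sol; rewrite sE.
have := @leq_bigmax_seq _ s predT (fun p => val p.2) _ sol_s isT.
by move: Nz; rewrite /N /=; lia.
Qed.
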